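(* Let $A,B$ be logically independent events. Given a coherent assessment $(x,y)$ on $\{A,B\}$, the extension $\mu=P(B|A)$ to the conditional event $B|A$ is coherent (i.e. $(x,y,\mu)$ is a coherent assessment on $\{A,B,B|A\}$) if and only if $\mu\in[\mu',\mu'']$, where $$\mu'=\begin{cases}\max\{\frac{x+y-1}{x},0\},& x>0,\\ 0,& x=0,\end{cases}\qquad \mu''=\begin{cases}\min\{\frac{y}{x},1\},& x>0,\\ 1,& x=0.\end{cases}$$
   Context: Events are elements of a Boolean algebra with sure event $\Omega$ and impossible event $\emptyset$; $\overline{E}$ is negation, $EF$ is conjunction, and an event is identified with its $0/1$ indicator. $A,B$ are logically independent if $AB,\ A\overline B,\ \overline AB,\ \overline A\,\overline B$ are all $\neq\emptyset$. An unconditional event $E$ is identified with $E|\Omega$. Coherence (de Finetti). A real assessment $(p_1,\dots,p_n)$ on a finite family of conditional events $\{E_1|H_1,\dots,E_n|H_n\}$ ($H_i\neq\emptyset$) is coherent if for every nonempty $S\subseteq\{1,\dots,n\}$ and all real $s_i$ ($i\in S$), the set $D$ of values of the random gain $G=\sum_{i\in S}s_iH_i(E_i-p_i)$ on the constituents (nonimpossible atoms generated by the $E_i,H_i$) contained in $\bigvee_{i\in S}H_i$ satisfies $\min D\le0\le\max D$. *)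

(* Defs.v *)
(* Events are the elements of an arbitrary Boolean algebra
   [T : ctbDistrLatticeType d]: the sure event is [\top], the impossible event
   [\bot], conjunction [`&`], disjunction [`|`], negation [~`]. *)
From HB Require Import structures.
From mathcomp Require Import all_boot all_order all_algebra.
From mathcomp Require Import reals.

Set Implicit Arguments.
Unset Strict Implicit.
Unset Printing Implicit Defensive.

Import Order.TTheory GRing.Theory Num.Theory.

Local Open Scope ring_scope.

Definition logically_independent (d : Order.disp_t) (T : ctbDistrLatticeType d)
    (A B : T) : Prop :=
  [/\ (A `&` B != \bot)%O, (A `&` ~` B != \bot)%O,
      (~` A `&` B != \bot)%O & (~` A `&` ~` B != \bot)%O].

(* The condition [given X != \bot] is imposed in [coherent]. *)
Record condEvent (d : Order.disp_t) (T : ctbDistrLatticeType d) : Type :=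
  CondEvent { conseq : T; given : T }.

Definition uncond (d : Order.disp_t) (T : ctbDistrLatticeType d) (E : T) :
    condEvent T :=
  CondEvent E \top%O.

Section Coherence.

Context (d : Order.disp_t) (T : ctbDistrLatticeType d) (R : realType).

Definition literal (b : bool) (E : T) : T := if b then E else (~` E)%O.

(* [c i] gives the polarities of the [i]-th event and of its conditioning
   event. *)
Definition atom (n : nat) (F : n.-tuple (condEvent T))
    (c : {ffun 'I_n -> bool * bool}) : T :=
  (\meet_(i < n) (literal (c i).1 (conseq (tnth F i))
                  `&` literal (c i).2 (given (tnth F i))))%O.

Definition constituents (n : nat) (F : n.-tuple (condEvent T)) : seq T :=
  [seq C <- [seq atom F c | c : {ffun 'I_n -> bool * bool}] | C != \bot%O].

(* The 0/1 indicator of [E] on [C]; a constituent [C] lies below exactly one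
   of [E] and [~` E] for every [E] among the generating events. *)
Definition indicator (E C : T) : R := ((C <= E)%O : bool)%:R.

Definition gain (n : nat) (F : n.-tuple (condEvent T)) (p : n.-tuple R)
    (S : {set 'I_n}) (s : 'I_n -> R) (C : T) : R :=
  \sum_(i in S) s i * indicator (given (tnth F i)) C
                * (indicator (conseq (tnth F i)) C - tnth p i).

Definition gain_values (n : nat) (F : n.-tuple (condEvent T)) (p : n.-tuple R)
    (S : {set 'I_n}) (s : 'I_n -> R) : seq R :=
  [seq gain F p S s C | C <- constituents F
                      & (C <= \join_(i in S) given (tnth F i))%O].

(* Minimum and maximum of a nonempty finite list; the value on [[::]] is junk,
   and [gain_values] is nonempty when [S] is nonempty and no conditioning event
   is impossible. *)
Definition seq_min (D : seq R) : R := \big[Num.min/head 0 D]_(g <- D) g.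
Definition seq_max (D : seq R) : R := \big[Num.max/head 0 D]_(g <- D) g.

Definition coherent (n : nat) (F : n.-tuple (condEvent T)) (p : n.-tuple R) :
    Prop :=
  (forall i : 'I_n, given (tnth F i) != \bot%O) /\
  (forall (S : {set 'I_n}) (s : 'I_n -> R), S != set0 ->
     seq_min (gain_values F p S s) <= 0 <= seq_max (gain_values F p S s)).

End Coherence.

(* The last branches stand for [x = 0]: a coherent [x] is nonnegative. *)
Definition mu_lower (R : realType) (x y : R) : R :=
  if 0 < x then Num.max ((x + y - 1) / x) 0 else 0.

Definition mu_upper (R : realType) (x y : R) : R :=
  if 0 < x then Num.min (y / x) 1 else 1.

(* Main.v *)
(* The gain on a constituent C is a function of the two booleans [C <= A] and
   [C <= B] alone.  Necessity: [a (b - mu) + mu (a - x)] is [a b - mu x], so the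
   stakes [(mu, -1, 1)] and [(mu - 1, -1, 1)] give Dutch books when [mu x > y]
   and [mu x < x + y - 1] respectively.  Sufficiency: the numbers [mu x],
   [x - mu x], [y - mu x], [1 - x - y + mu x] are a probability distribution on
   the four constituents for which every gain has mean zero, so no gain has
   constant strict sign.  A bet on [B|A] alone only sees the constituents below
   [A], where the distribution [(mu, 1 - mu)] does the same. *)
Require Import Defs.
From mathcomp Require Import all_boot all_order all_algebra.
From mathcomp Require Import reals.
From mathcomp Require Import ring lra.

Set Implicit Arguments.
Unset Strict Implicit.
Unset Printing Implicit Defensive.

Import Order.Theory GRing.Theory Num.Theory.

Local Open Scope ring_scope.

Section SeqExtrema.

Context (R : realType).
Implicit Types (D : seq R) (g : R).

Lemma seq_min_le D g : g \in D -> seq_min D <= g.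
Proof. by move=> gD; rewrite /seq_min; exact: ge_bigmin_seq gD _. Qed.

Lemma seq_max_ge D g : g \in D -> g <= seq_max D.
Proof. by move=> gD; rewrite /seq_max; exact: le_bigmax_seq gD _. Qed.

(** The seed of the folds [seq_min] and [seq_max] is an entry of a nonempty list, so both extrema
    are attained. *)
Lemma mem_head_nonempty D g : g \in D -> head 0 D \in D.
Proof. by case: D => // h D _; exact: mem_head. Qed.

Lemma seq_min_mem D g : g \in D -> seq_min D \in D.
Proof.
move=> /mem_head_nonempty hD; rewrite /seq_min big_seq.
apply: (big_ind (fun z => z \in D)) => // u v uD vD.
by rewrite minEle; case: ifP.
Qed.

Lemma seq_max_mem D g : g \in D -> seq_max D \in D.
Proof.
move=> /mem_head_nonempty hD; rewrite /seq_max big_seq.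
apply: (big_ind (fun z => z \in D)) => // u v uD vD.
by rewrite maxEle; case: ifP.
Qed.

End SeqExtrema.

(** Otherwise [g] is positive wherever [w] is, so the terms [w i * g i] are nonnegative with sum
    zero. They all vanish, hence [w] vanishes, against its total mass 1. *)
Lemma mean0_exists_le0 (R : realType) (I : finType) (w g : I -> R) :
  (forall i, 0 <= w i) -> \sum_i w i = 1 -> \sum_i w i * g i = 0 ->
  exists2 i, 0 < w i & g i <= 0.
Proof.
move=> w0 w1 wg0.
have [/existsP[i /andP[]]|] := boolP [exists i, (0 < w i) && (g i <= 0)].
  by exists i.
rewrite negb_exists => /forallP gpos.
have wg_ge0 i : true -> 0 <= w i * g i.
  move=> _; have := gpos i; rewrite negb_and -leNgt -ltNge.
  case/orP => [wi|/ltW gi]; last exact: mulr_ge0.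
  by rewrite (@le_anti _ _ (w i) 0) ?mul0r// wi w0.
have /psumr_eq0P : \sum_i w i * g i = 0 by [].
move=> /(_ wg_ge0) wgi; exfalso.
have : \sum_i w i = 0.
  apply: big1 => i _; apply/eqP; have := gpos i.
  rewrite negb_and -leNgt -ltNge => /orP[wi|gi]; first by rewrite eq_le wi w0.
  by have /eqP := wgi i isT; rewrite mulf_eq0 (gt_eqF gi) orbF.
by rewrite w1 => /eqP; rewrite oner_eq0.
Qed.

Section Cells.

Context (d : Order.disp_t) (T : ctbDistrLatticeType d) (R : realType).
Implicit Types (A B C E : T).

Definition cell A B (ab : bool * bool) : T :=
  (literal ab.1 A `&` literal ab.2 B)%O.

Lemma cell_neq_bot A B ab : logically_independent A B -> cell A B ab != \bot%O.
Proof. by case: ab => [] [] [] []. Qed.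

Lemma le_literal C E b :
  C != \bot%O -> (C <= literal b E)%O -> (C <= E)%O = b.
Proof.
case: b => //= C0 CE; apply: contraNF C0 => CE'.
by rewrite -lex0 -(meetxC E) lexI CE'.
Qed.

Lemma cell_le1 A B ab : logically_independent A B ->
  (cell A B ab <= A)%O = ab.1.
Proof. by move=> /cell_neq_bot AB; apply: le_literal => //; exact: leIl. Qed.

Lemma cell_le2 A B ab : logically_independent A B ->
  (cell A B ab <= B)%O = ab.2.
Proof. by move=> /cell_neq_bot AB; apply: le_literal => //; exact: leIr. Qed.

Lemma mem_constituents n (F : n.-tuple (condEvent T)) c :
  atom F c != \bot%O -> atom F c \in constituents F.
Proof.
by move=> c0; rewrite mem_filter c0; apply/mapP; exists c; rewrite ?mem_enum.
Qed.

Lemma cell_constituent2 A B ab : logically_independent A B ->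
  cell A B ab \in constituents [tuple uncond A; uncond B].
Proof.
move=> AB; pose c : {ffun 'I_2 -> bool * bool} :=
  [ffun i => tnth [tuple (ab.1, true); (ab.2, true)] i].
have cE : atom [tuple uncond A; uncond B] c = cell A B ab.
  by rewrite /atom !big_ord_recl big_ord0 !ffunE /= !meetx1.
by rewrite -cE mem_constituents// cE cell_neq_bot.
Qed.

Lemma cell_constituent3 A B ab : logically_independent A B ->
  cell A B ab \in constituents [tuple uncond A; uncond B; CondEvent B A].
Proof.
(* The third entry repeats the polarities of [B] and [A], so the literals of [B|A] are absorbed by
   those of the first two events. *)
move=> AB; pose c : {ffun 'I_3 -> bool * bool} :=
  [ffun i => tnth [tuple (ab.1, true); (ab.2, true); (ab.2, ab.1)] i].
have cE : atom [tuple uncond A; uncond B; CondEvent B A] c = cell A B ab.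
  by rewrite /atom !big_ord_recl big_ord0 !ffunE /= !meetx1 meetKI meetKIC.
by rewrite -cE mem_constituents// cE cell_neq_bot.
Qed.

(** [C] witnesses that the list of gains is nonempty, so its minimum and maximum are genuine gains
    and not the default value. *)
Lemma coherent_gains n (F : n.-tuple (condEvent T)) (p : n.-tuple R) S s C :
  coherent F p -> S != set0 -> C \in constituents F ->
  (C <= \join_(i in S) given (tnth F i))%O ->
  exists C1 C2, [/\ (C1 <= \join_(i in S) given (tnth F i))%O,
    (C2 <= \join_(i in S) given (tnth F i))%O,
    gain F p S s C1 <= 0 & 0 <= gain F p S s C2].
Proof.
move=> [_ cohFp] S0 CF CS.
have gC : gain F p S s C \in gain_values F p S s.
  by apply/mapP; exists C; rewrite // mem_filter CS.
have /andP[] := cohFp S s S0.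
have /mapP[C1] := seq_min_mem gC; rewrite mem_filter => /andP[C1S _] ->.
have /mapP[C2] := seq_max_mem gC; rewrite mem_filter => /andP[C2S _] -> g1 g2.
by exists C1, C2.
Qed.

(** A unit bet on one event of price [p] gains [- p] or [1 - p]; a gain [<= 0] forces [0 <= p], a
    gain [>= 0] forces [p <= 1]. *)
Lemma uncond_pair_bounds A B (x y : R) : logically_independent A B ->
  coherent [tuple uncond A; uncond B] [tuple x; y] ->
  0 <= x <= 1 /\ 0 <= y <= 1.
Proof.
move=> AB coh.
have bounds i : 0 <= tnth [tuple x; y] i <= 1.
  have [||C1 [C2 [_ _]]] := coherent_gains (S := [set i]) (fun=> 1) coh _
    (cell_constituent2 (true, true) AB).
  - by apply/set0Pn; exists i; rewrite inE.
  - by rewrite big_set1; case: i => -[|[|//]] ?; rewrite lex1.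
  rewrite /gain !big_set1 /indicator.
  by case: i => -[|[|//]] ? /=; rewrite !lex1 (tnth_nth 0) /=;
    case: (C1 <= _)%O; case: (C2 <= _)%O => /= *; apply/andP; split; lra.
by split; [have := bounds ord0 | have := bounds ord_max].
Qed.

Local Notation F3 A B := [tuple uncond A; uncond B; CondEvent B A].

(** Stakes outside [S] are set to zero, so that one formula covers every [S]. *)
Lemma gain3E A B (x y mu : R) S s C :
  gain (F3 A B) [tuple x; y; mu] S s C =
  (if ord0 \in S then s ord0 else 0) * ((C <= A)%O%:R - x) +
  (if lift ord0 ord0 \in S then s (lift ord0 ord0) else 0)
    * ((C <= B)%O%:R - y) +
  (if lift ord0 (lift ord0 ord0) \in S
   then s (lift ord0 (lift ord0 ord0)) else 0)
    * ((C <= A)%O%:R * ((C <= B)%O%:R - mu)).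
Proof.
rewrite /gain big_mkcond !big_ord_recl big_ord0 /indicator /= !lex1.
rewrite !(tnth_nth 0) /=.
by do 3 case: ifP => _; ring.
Qed.

Lemma join_given_lt2 A B (S : {set 'I_3}) i : i \in S -> (i < 2)%N ->
  (\join_(i in S) given (tnth (F3 A B) i))%O = \top%O.
Proof.
move=> iS i2; apply/eqP; rewrite -le1x; apply: (joins_min (j := i)) => //.
by case: i i2 {iS} => -[|[|//]].
Qed.

Lemma cond_extension_bounds A B (x y mu : R) : logically_independent A B ->
  coherent (F3 A B) [tuple x; y; mu] ->
  [/\ 0 <= mu <= 1, mu * x <= y & x + y - 1 <= mu * x].
Proof.
move=> AB coh; pose C := cell A B (true, true).
have CF : C \in constituents (F3 A B) by exact: cell_constituent3.
have setT0 : [set: 'I_3] != set0 by apply/set0Pn; exists ord0.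
have CT : (C <= \join_(i in [set: 'I_3]) given (tnth (F3 A B) i))%O.
  by rewrite (@join_given_lt2 _ _ _ ord0)// lex1.
split.
(* A unit bet on [B|A] alone: [C1] and [C2] lie below [A], where the gain is the indicator of [B]
   minus [mu]. *)
- pose k : 'I_3 := lift ord0 (lift ord0 ord0).
  have [||C1 [C2]] := coherent_gains (S := [set k]) (fun=> 1) coh _ CF.
  + by apply/set0Pn; exists k; rewrite inE.
  + by rewrite big_set1 /=; exact: leIl.
  rewrite big_set1 /= => -[C1A C2A]; rewrite !gain3E !inE /= C1A C2A.
  by case: (C1 <= B)%O; case: (C2 <= B)%O => /= *; apply/andP; split; lra.
(* With [a], [b] the indicators of [A], [B], the gain is [y - mu * x - (1 - a) * b], at most
   [y - mu * x]. *)
- have [C1 [C2 [_ _ _]]] :=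
    coherent_gains (tnth [tuple mu; -1; 1]) coh setT0 CF CT.
  rewrite gain3E !inE !(tnth_nth 0) /=.
  by case: (C2 <= A)%O; case: (C2 <= B)%O => /=; lra.
(* Here the gain is [x + y - 1 - mu * x + (1 - a) * (1 - b)], at least [x + y - 1 - mu * x]. *)
- have [C1 [C2 [_ _ + _]]] :=
    coherent_gains (tnth [tuple mu - 1; -1; 1]) coh setT0 CF CT.
  rewrite gain3E !inE !(tnth_nth 0) /=.
  by case: (C1 <= A)%O; case: (C1 <= B)%O => /=; lra.
Qed.

(** The weights may depend on [S] but not on the stakes. Zero mean yields a gain [<= 0] and, applied
    to the opposite gains, one [>= 0], both on constituents where some bet of [S] is active. *)
Lemma coherent_of_distributions n (F : n.-tuple (condEvent T))
    (p : n.-tuple R) (I : finType) (K : I -> T) :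
  (forall i, given (tnth F i) != \bot%O) ->
  (forall k, K k \in constituents F) ->
  (forall S : {set 'I_n}, S != set0 -> exists w : I -> R,
    [/\ forall k, 0 <= w k, \sum_k w k = 1,
      forall k, 0 < w k -> (K k <= \join_(i in S) given (tnth F i))%O &
      forall s, \sum_k w k * gain F p S s (K k) = 0]) ->
  coherent F p.
Proof.
move=> F0 KF wit; split=> // S s /wit[w [w0 w1 wS wg]].
have gK k : 0 < w k -> gain F p S s (K k) \in gain_values F p S s.
  by move=> /wS kS; apply/mapP; exists (K k); rewrite // mem_filter kS KF.
have [k /gK kD k_le0] := mean0_exists_le0 w0 w1 (wg s).
have [|l /gK lD l_ge0] :=
  mean0_exists_le0 (g := fun l => - gain F p S s (K l)) w0 w1.
  by under eq_bigr do rewrite mulrN; rewrite sumrN wg oppr0.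
rewrite oppr_le0 in l_ge0.
by rewrite (le_trans (seq_min_le kD))//= (le_trans l_ge0) ?seq_max_ge.
Qed.

Lemma cond_extension_coherent A B (x y mu : R) : logically_independent A B ->
  0 <= x <= 1 -> 0 <= mu <= 1 -> mu * x <= y -> x + y - 1 <= mu * x ->
  coherent (F3 A B) [tuple x; y; mu].
Proof.
move=> AB x01 mu01 mu_y mu_xy.
have A0 : A != \bot%O.
  apply: contraTneq (cell_neq_bot (true, true) AB) => ->.
  by rewrite /cell /= meet0x eqxx.
have T0 : \top%O != \bot%O :> T.
  by apply: contraNneq A0 => T0; rewrite -lex0 -T0 lex1.
apply: (coherent_of_distributions (K := cell A B)) => [i|ab|S S0].
- by case: i => -[|[|[|//]]].
- exact: cell_constituent3.
have sum_cells (h : bool * bool -> R) : \sum_ab h ab =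
    h (true, true) + h (true, false) + (h (false, true) + h (false, false)).
  transitivity (\sum_a \sum_b h (a, b)); last by rewrite !big_bool.
  by rewrite pair_bigA; apply: eq_bigr => -[].
(* Either [S] contains an unconditional event and every constituent counts, or [S] consists of [B|A]
   alone. *)
have [/existsP[i /andP[iS i2]]|noAB] :=
  boolP [exists i : 'I_3, (i \in S) && (i < 2)%N].
- exists (fun ab : bool * bool => match ab with
    | (true, true) => mu * x | (true, false) => x - mu * x
    | (false, true) => y - mu * x | (false, false) => 1 - x - y + mu * x end).
  split.
  (* Two masses are the products [mu * x] and [(1 - mu) * x]; the other two are nonnegative by
     [mu_y] and [mu_xy]. *)
  + by case=> [] [] []; nra.
  + by rewrite sum_cells; ring.
  + by move=> ab _; rewrite (join_given_lt2 _ _ iS i2) lex1.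
  + by move=> s; rewrite sum_cells !gain3E !cell_le1// !cell_le2//=; ring.
- have notS (i : 'I_3) : (i < 2)%N -> (i \in S) = false.
    move=> i2; apply: contraNF noAB => iS.
    by apply/existsP; exists i; rewrite iS.
  (* The distribution conditional on [A], written without dividing by [x] so that it also serves
     when [x = 0]. *)
  exists (fun ab : bool * bool => match ab with
    | (true, true) => mu | (true, false) => 1 - mu | (false, _) => 0 end).
  split.
  + by case=> [] [] [] => /=; lra.
  + by rewrite sum_cells; ring.
  + case=> [] [] b w0; last by case: b w0; rewrite ltxx.
    have /set0Pn[i iS] := S0; apply: (joins_min (j := i)) => //.
    have : ~~ (i < 2)%N by apply: contraTN iS => /notS ->.
    case: i {iS} => -[|[|[|//]]]// *.
    rewrite (tnth_nth (uncond A)); exact: leIl.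
  + move=> s; rewrite sum_cells !gain3E !cell_le1// !cell_le2//=.
    by rewrite (notS ord0)// (notS (lift ord0 ord0))//; ring.
Qed.

(** For [0 < x], clear the denominators. For [x = 0] the last two inequalities read [0 <= y] and
    [y <= 1], which leaves only [0 <= mu <= 1]. *)
Lemma mem_mu_interval (x y mu : R) : 0 <= x <= 1 -> 0 <= y <= 1 ->
  mu \in `[mu_lower x y, mu_upper x y] <->
  [/\ 0 <= mu <= 1, mu * x <= y & x + y - 1 <= mu * x].
Proof.
move=> /andP[x0 x1] y01; rewrite in_itv /= /mu_lower /mu_upper.
case: ltgtP x0 => // [x0 _|<- _].
- rewrite ge_max le_min ler_pdivrMr// ler_pdivlMr//.
  split=> [/andP[/andP[-> ->] /andP[-> ->]]|[/andP[-> ->] -> ->]] //.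
- by split=> [mu01|[]//]; split=> //; lra.
Qed.

End Cells.

Theorem theorem6 (d : Order.disp_t) (T : ctbDistrLatticeType d) (R : realType)
    (A B : T) (x y : R) :
  logically_independent A B ->
  coherent [tuple uncond A; uncond B] [tuple x; y] ->
  forall mu : R,
    coherent [tuple uncond A; uncond B; CondEvent B A] [tuple x; y; mu] <->
    mu \in `[mu_lower x y, mu_upper x y].
Proof.
move=> AB /(uncond_pair_bounds AB)[x01 y01] mu; rewrite mem_mu_interval//.
split=> [|[mu01 mu_y mu_xy]]; first exact: cond_extension_bounds.
exact: cond_extension_coherent.
Qed.
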